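(* For all integers $k \ge 1$ and $v \ge 1$, \[ \mu(k,v) = \frac{(v+1)^{k+1} - (v+1)}{v}. \]
   Context: All graphs are finite and simple. An interval graph is the intersection graph of a finite family of open intervals of the real line (vertices correspond to intervals, two vertices adjacent iff the intervals intersect). The claw number $\psi(G)$ of a graph $G$ is the largest integer $v \ge 0$ such that the star $K_{1,v}$ is an induced subgraph of $G$. A vertex partition of $G$ into $k$ induced subgraphs means a partition of $V(G)$ into $k$ subsets together with the induced subgraphs on them. For $k \ge 1$ and $v \ge 1$, $\mu(k,v)$ denotes the largest integer $n$ such that every interval graph with $n$ vertices admits a vertex partition into $k$ induced subgraphs each with claw number at most $v$. *)

(* Defs.v *)
From HB Require Import structures.
From mathcomp Require Import all_boot all_order all_algebra.
From mathcomp Require Import classical_sets reals set_interval.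

Set Implicit Arguments.
Unset Strict Implicit.
Unset Printing Implicit Defensive.

Import Order.TTheory GRing.Theory Num.Theory.

Record sgraph := SGraph {
  vertex :> finType;
  adj : rel vertex;
  adj_sym : symmetric adj;
  adj_irrefl : irreflexive adj }.
Arguments adj {s}.

Section Induced.
Variables (G : sgraph) (A : {set G}).

Definition induced_adj : rel {x : G | x \in A} :=
  fun x y => adj (val x) (val y).

Lemma induced_adj_sym : symmetric induced_adj.
Proof. by move=> x y; rewrite /induced_adj adj_sym. Qed.

Lemma induced_adj_irrefl : irreflexive induced_adj.
Proof. by move=> x; rewrite /induced_adj adj_irrefl. Qed.

Definition induced : sgraph := SGraph induced_adj_sym induced_adj_irrefl.
End Induced.

Section Star.
Variable v : nat.

(* [None] is the centre of K_{1,v}, the [Some i] are its v leaves. *)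
Definition star_adj : rel (option 'I_v) := fun x y => isSome x (+) isSome y.

Lemma star_adj_sym : symmetric star_adj.
Proof. by move=> x y; rewrite /star_adj addbC. Qed.

Lemma star_adj_irrefl : irreflexive star_adj.
Proof. by move=> x; rewrite /star_adj addbb. Qed.

Definition star : sgraph := SGraph star_adj_sym star_adj_irrefl.
End Star.

(* Up to isomorphism. *)
Definition is_induced_subgraph (H G : sgraph) : bool :=
  [exists f : {ffun H -> G},
     injectiveb f && [forall x, forall y, adj (f x) (f y) == adj x y]].

(* The bound on the range loses nothing: an induced K_{1,v} has v + 1 vertices.
   The graph without vertices, which contains not even K_{1,0}, gets 0. *)
Definition claw_number (G : sgraph) : nat :=
  \max_(v < #|G|.+1 | is_induced_subgraph (star v) G) v.

Local Open Scope classical_set_scope.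
Local Open Scope ring_scope.

(* Distinct vertices may carry the same interval. *)
Definition interval_graph (R : realType) (G : sgraph) : Prop :=
  exists a b : G -> R,
    (forall x, a x < b x) /\
    (forall x y, x != y ->
       (adj x y <-> `]a x, b x[ `&` `]a y, b y[ !=set0)).

Local Open Scope nat_scope.

(* The parts are the fibres of [c]; some of them may be empty. *)
Definition claw_partition (k v : nat) (G : sgraph) : Prop :=
  exists c : G -> 'I_k,
    forall i : 'I_k, claw_number (induced [set x | c x == i]%SET) <= v.

Definition all_claw_partition (R : realType) (k v n : nat) : Prop :=
  forall G : sgraph, #|G| = n -> interval_graph R G -> claw_partition k v G.

(* [is_mu R k v n] says that mu(k, v) exists and equals [n]. *)
Definition is_mu (R : realType) (k v n : nat) : Prop :=
  all_claw_partition R k v n /\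
  forall m : nat, all_claw_partition R k v m -> m <= n.

(* Main.v *)
(** Write d = v + 1 and N_k = d + d^2 + ... + d^k, so that N_{k+1} = d (N_k + 1).

    Every interval graph on at most N_k vertices is partitionable, by induction
    on k.  Sweep from the left, with m = N_k: let x be the interval with the
    (m+1)-st smallest right endpoint.  The m intervals ending before x form a
    block that k colours suffice for, the other intervals starting before x
    ends form a clique, and the sweep continues with what lies to the right of
    x.  The last colour gets the cliques met on the way.  If v cliques suffice,
    their union has no v + 1 independent vertices.  Otherwise the count
    d (N_k + 1) is attained with equality, each clique is a single vertex, and
    one further vertex may be added: a class with v + 1 vertices contains no
    K_{1,v+1}.

    Conversely, the d-adic intervals of lengths 1, d, ..., d^k inside [0, d^k)
    number N_k + 1, and an induction on the length shows that the intervals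
    inside one of length d^h use at least h + 1 colours: the colour of that
    interval is missing from one of its d children, as otherwise it would be
    the centre of a K_{1,d} of its own colour. *)

Require Import Defs.
From HB Require Import structures.
From mathcomp Require Import all_boot all_order all_algebra.
From mathcomp Require Import classical_sets reals set_interval.
(* Re-imported last: [set0], [setT], [subsetP] are then those of [finset]. *)
From mathcomp Require Import fintype finset zify ring.

Import Order.TTheory GRing.Theory Num.Theory.

(** * Claws and colourings of vertex subsets *)

Section Claws.
Variable G : sgraph.
Implicit Types A C S L : {set G}.

Definition independent L := forall y z, y \in L -> z \in L -> ~~ adj y z.

Definition independence_le (j : nat) A :=
  forall L, L \subset A -> independent L -> #|L| <= j.

Definition claw_le (v : nat) A :=
  forall x L, x \in A -> L \subset A -> (forall y, y \in L -> adj x y) ->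
    independent L -> #|L| <= v.

(** Trades star embeddings into a subtype for a centre and a leaf set in [G]: the image of the
    leaves one way, an enumeration of [L] the other. *)
Lemma claw_number_inducedP (v : nat) A :
  claw_number (induced A) <= v <-> claw_le v A.
Proof.
split=> [le_v x L xA LA adjL indL|clawA]; last first.
  apply/bigmax_leqP => w /existsP[f /andP[/injectiveP injf /forallP adjf]].
  have adjfE s t : adj (val (f s)) (val (f t)) = star_adj s t.
    by move/forallP: (adjf s) => /(_ t) /eqP.
  pose g (i : 'I_w) := val (f (Some i)).
  have injg : injective g by move=> i j /val_inj /injf [].
  have <- : #|g @: setT| = w by rewrite card_imset // cardsT card_ord.
  apply: (clawA (val (f None))).
  - exact: valP.
  - by apply/subsetP => _ /imsetP[i _ ->]; exact: valP.
  - by move=> _ /imsetP[i _ ->]; rewrite adjfE.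
  - by move=> _ _ /imsetP[i _ ->] /imsetP[j _ ->]; rewrite adjfE.
apply: leq_trans le_v.
have LA' y : y \in L -> y \in A by apply/subsetP.
have sizeL : #|L| < #|induced A|.+1.
  by rewrite /= card_sig ltnS; apply: subset_leq_card; apply/subsetP.
pose leaf (i : 'I_#|L|) : induced A := exist (fun y => y \in A) _ (LA' _ (enum_valP i)).
pose f (s : star #|L|) : induced A :=
  if s is Some i then leaf i else exist (fun y => y \in A) x xA.
have adjx i : adj x (val (leaf i)) by apply: adjL; exact: enum_valP.
apply: (leq_bigmax_cond (Ordinal sizeL)).
apply/existsP; exists (finfun f); apply/andP; split.
  apply/injectiveP => s t; rewrite !ffunE.
  case: s t => [i|] [j|] //= /(congr1 val) /= E.
  - by congr Some; exact: enum_val_inj E.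
  - by move: (adjx i); rewrite /= E adj_irrefl.
  - by move: (adjx j); rewrite /= -E adj_irrefl.
apply/forallP => s; apply/forallP => t; rewrite !ffunE.
case: s t => [i|] [j|]; rewrite /= /induced_adj /star_adj /=.
- by rewrite (negbTE (indL _ _ (enum_valP i) (enum_valP j))).
- by rewrite adj_sym (adjx i).
- by rewrite (adjx j).
- by rewrite adj_irrefl.
Qed.

Lemma claw_le_sub (v : nat) A S : A \subset S -> claw_le v S -> claw_le v A.
Proof.
move=> AS clawS x L xA LA; apply: clawS; first exact: (subsetP AS).
exact: subset_trans AS.
Qed.

Lemma independence_le_claw (v : nat) A : independence_le v A -> claw_le v A.
Proof. by move=> indA x L _ LA _; exact: indA. Qed.

Lemma card_le_claw (v : nat) A : #|A| <= v.+1 -> claw_le v A.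
Proof.
move=> leA x L xA LA adjL _; rewrite -ltnS; apply: leq_trans leA.
have xL : x \notin L by apply/negP => /adjL; rewrite adj_irrefl.
rewrite -[X in X <= _](_ : #|x |: L| = _); last by rewrite cardsU1 xL.
by apply: subset_leq_card; rewrite subUset sub1set xA.
Qed.

(** An independent set meets a clique in at most one vertex. *)
Lemma independence_leU1 (j : nat) C A :
  {in C &, forall y z, y != z -> adj y z} -> independence_le j A ->
  independence_le j.+1 (C :|: A).
Proof.
move=> cliqueC indA L LCA indL; rewrite -(cardsID C L) -add1n leq_add //.
  apply/card_le1_eqP => y z; rewrite !inE => /andP[yL yC] /andP[zL zC].
  by apply: contraNeq (indL _ _ yL zL); rewrite eq_sym; apply: cliqueC.
apply: indA; first by rewrite subDset.
by move=> y z /setDP[yL _] /setDP[zL _]; exact: indL.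
Qed.

(** With natural numbers as colours, a new colour [k] extends a colouring as it is, and the empty
    set is covered even for [k = 0]. *)
Definition partitionable (v k : nat) S :=
  exists c : G -> nat, (forall x, x \in S -> c x < k) /\
    forall i, claw_le v [set x in S | c x == i].

Lemma partitionable0 (v k : nat) : partitionable v k set0.
Proof.
exists (fun=> 0); split=> [x|i x L]; first by rewrite inE.
by rewrite !inE.
Qed.

(** A claw is connected, so it lies on one side, and both sides can share the same colours. *)
Lemma partitionableU (v k : nat) S1 S2 :
  (forall x y, x \in S1 -> y \in S2 -> ~~ adj x y) ->
  partitionable v k S1 -> partitionable v k S2 ->
  partitionable v k (S1 :|: S2).
Proof.
move=> noadj [c1 [ltc1 claw1]] [c2 [ltc2 claw2]].
exists (fun x => if x \in S1 then c1 x else c2 x); split=> [x|i x L].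
  by rewrite inE; case: ifP => [/ltc1|_ /ltc2].
rewrite !inE => /andP[xS cx] LS adjL indL.
have LS' y : y \in L -> ((y \in S1) || (y \in S2)) &&
    ((if y \in S1 then c1 y else c2 y) == i).
  by move=> /(subsetP LS); rewrite !inE.
case: (boolP (x \in S1)) xS cx => [xS1 _ cx|xS1 /= xS2 cx].
  apply: (claw1 i x) => //; first by rewrite inE xS1.
  apply/subsetP => y yL; rewrite inE.
  have := LS' _ yL; case: ifP => //= _ /andP[yS2 _].
  by have := noadj _ _ xS1 yS2; rewrite adjL.
apply: (claw2 i x) => //; first by rewrite inE xS2.
apply/subsetP => y yL; rewrite inE.
have := LS' _ yL; case: ifP => //= yS1 _.
by have := noadj _ _ yS1 xS2; rewrite adj_sym adjL.
Qed.

Lemma partitionableS (v k : nat) S A : A \subset S -> claw_le v A ->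
  partitionable v k (S :\: A) -> partitionable v k.+1 S.
Proof.
move=> AS clawA [c [ltc clawc]].
exists (fun x => if x \in A then k else c x); split=> [x xS|i].
  by case: ifP => // xA; rewrite ltnS ltnW // ltc // inE xA.
case: (eqVneq i k) => [->|neq_ik].
  apply: claw_le_sub clawA; apply/subsetP => x.
  rewrite inE; case: ifP => // xA /andP[xS /eqP cx].
  by have := ltc x; rewrite inE xA xS cx ltnn => /(_ isT).
apply: claw_le_sub (clawc i); apply/subsetP => x.
rewrite !inE; case: ifP => xA /andP[-> //].
by rewrite eq_sym (negbTE neq_ik).
Qed.

Lemma partitionableT (v k : nat) : 0 < k -> partitionable v k setT ->
  claw_partition k v G.
Proof.
case: k => // k _ [c [ltc clawc]]; exists (fun x => inord (c x)) => i.
apply/claw_number_inducedP; apply: claw_le_sub (clawc i).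
apply/subsetP => x; rewrite !inE /= => /eqP <-.
by rewrite inordK // ltc.
Qed.

End Claws.

Arguments independent {G}.
Arguments independence_le {G}.
Arguments claw_le {G}.
Arguments partitionable {G}.

(** * Lower bound: the sweep from the left *)

Lemma card_initial_segment d (T : finType) (O : orderType d) (b : T -> O)
    (S : {set T}) (m : nat) : m <= #|S| ->
  exists I : {set T}, [/\ I \subset S, #|I| = m &
    forall y z, y \in I -> z \in S :\: I -> (b y <= b z)%O].
Proof.
elim: m => [_|m IHm ltmS].
  by exists set0; rewrite sub0set cards0; split=> // y z; rewrite inE.
have [I [IS cardI leI]] := IHm (ltnW ltmS).
have /card_gt0P[x0 x0D] : 0 < #|S :\: I|.
  by rewrite cardsD (setIidPr IS) cardI subn_gt0.
case: (Order.TotalTheory.arg_minP b x0D) => x /setDP[xS xI] minx.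
exists (x |: I); split.
- by rewrite subUset sub1set xS.
- by rewrite cardsU1 xI cardI.
- move=> y z /setU1P[->|yI] /setDP[zS]; rewrite !inE negb_or => /andP[_ zI].
    by apply: minx; apply/setDP.
  by apply: leI => //; apply/setDP.
Qed.

Fixpoint mu_value (v k : nat) :=
  if k is k'.+1 then v.+1 * (mu_value v k').+1 else 0.

Section Sweep.
Variables (R : realType) (G : sgraph) (a b : G -> R) (v : nat).
Hypothesis adjE : forall x y : G, x != y ->
  adj x y = (a x < b y)%R && (a y < b x)%R.
Hypothesis ltab : forall x : G, (a x < b x)%R.

(** [A] is the class of the last colour, gathered from at most [j] cliques. The second alternative
    is the extremal count: all cliques are then singletons, and one extra vertex joins them. *)
Lemma sweep (k m : nat) :
  (forall S : {set G}, #|S| <= m -> partitionable v k S) ->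
  forall j (S : {set G}), #|S| <= j.+1 * m.+1 ->
  exists A : {set G}, [/\ A \subset S, partitionable v k (S :\: A) &
    independence_le j A \/ #|A| <= j.+1 /\ #|S| = j.+1 * m.+1].
Proof.
move=> partm; elim=> [|j IHj] S leS; case: (leqP #|S| m) => [leSm|ltmS].
- exists set0; rewrite sub0set setD0; split=> //; first exact: partm.
  by left=> L; rewrite subset0 => /eqP ->; rewrite cards0.
(* No clique is allowed and [S] is one vertex too large: any vertex serves as the extra one. *)
- have /card_gt0P[x xS] : 0 < #|S| by apply: leq_trans ltmS.
  have cardS : #|S| = m.+1 by apply/eqP; rewrite eqn_leq ltmS -[m.+1]mul1n leS.
  exists [set x]; rewrite sub1set xS; split=> //; last first.
    by right; rewrite cards1 cardS mul1n.
  by apply: partm; move: (cardsD1 x S); rewrite xS cardS; lia.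
- exists set0; rewrite sub0set setD0; split=> //; first exact: partm.
  by left=> L; rewrite subset0 => /eqP ->; rewrite cards0.
have [T [TS cardT leT]] := card_initial_segment _ _ _ b S m (ltnW ltmS).
have cardST : #|S :\: T| = #|S| - m by rewrite cardsD (setIidPr TS) cardT.
have /card_gt0P[x0 x0D] : 0 < #|S :\: T| by rewrite cardST subn_gt0.
case: (Order.TotalTheory.arg_minP b x0D) => x xST minx.
have xD : x \in S :\: T by [].
(* Members of [C] all contain the points just left of [b x]. Those of [T] end at [b x] or before,
   those of [S'] start there or later. *)
pose C := [set y in S :\: T | (a y < b x)%R].
have CST : C \subset S :\: T by apply/subsetP => y; rewrite inE => /andP[].
pose S' := S :\: T :\: C.
have xC : x \in C by rewrite inE xD ltab.
have C_gt0 : 0 < #|C| by apply/card_gt0P; exists x.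
have cardS' : #|S'| + #|C| + m = #|S|.
  have := cardsID C (S :\: T); rewrite -/S' (setIidPr CST) cardST; lia.
have [] := IHj S'; first by move: leS; rewrite [j.+2 * _]mulSn; lia.
move=> A [AS' partA indA]; exists (C :|: A).
have cliqueC : {in C &, forall y z, y != z -> adj y z}.
  have CP y : y \in C -> (a y < b x)%R /\ (b x <= b y)%R.
    by rewrite inE => /andP[yD ay]; split=> //; exact: minx.
  move=> y z /CP[ay by_] /CP[az bz] yz.
  by rewrite adjE // (lt_le_trans ay) ?(lt_le_trans az).
split.
- rewrite subUset (subset_trans CST (subsetDl _ _)).
  by rewrite (subset_trans AS') // /S' setDDl subsetDl.
- have -> : S :\: (C :|: A) = T :|: (S' :\: A).
    apply/setP => y; rewrite !inE.
    case: (boolP (y \in T)) => [yT|yT]; last first.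
      by case: (y \in S); case: (y \in A); case: (_ < _)%R.
    rewrite (subsetP TS) //= andbT.
    apply/negP => yA; have := subsetP AS' y yA.
    by rewrite !inE yT.
  apply: partitionableU partA; last by apply: partm; rewrite cardT.
  move=> y z yT; rewrite !inE => /andP[_ /andP[azx /andP[zT zS]]].
  have yz : y != z by apply: contraNneq zT => <-.
  move: azx; rewrite zT zS /= -leNgt => azx.
  by rewrite adjE // negb_and -!leNgt (le_trans _ azx) ?orbT // leT.
- case: indA => [indA|[leA cardS'E]]; first by left; exact: independence_leU1.
  (* As [S'] attains its bound, a second vertex in [C] would push [#|S|] above [j.+2 * m.+1]. *)
  case: (leqP #|C| 1) => [leC1|ltC1].
    right; split; last by rewrite [j.+2 * _]mulSn; lia.
    by apply: leq_trans (leq_card_setU _ _) _; lia.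
  by move: leS; rewrite [j.+2 * _]mulSn; lia.
Qed.

Lemma partitionable_card (k : nat) (S : {set G}) :
  #|S| <= mu_value v k -> partitionable v k S.
Proof.
elim: k S => [|k IHk] S leS.
  by move: leS; rewrite leqn0 cards_eq0 => /eqP ->; exact: partitionable0.
(* For m = N_k and j = v, the bound (j+1)(m+1) is N_{k+1}. *)
have [A [AS partA indA]] := sweep k (mu_value v k) IHk v S leS.
apply: partitionableS partA => //.
case: indA => [|[leA _]]; first exact: independence_le_claw.
exact: card_le_claw.
Qed.

End Sweep.

Lemma open_itvs_meetE (R : realType) (a b c d : R) : (a < b -> c < d ->
  (`]a, b[%classic `&` `]c, d[%classic !=set0)%classic <->
  ((a < d) && (c < b)))%R.
Proof.
move=> ab cd; split=> [[x []]|/andP[ad cb]] /=.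
  rewrite !in_itv /= => /andP[ax xb] /andP[cx xd].
  by rewrite (lt_trans ax) // (lt_trans cx).
have lt_mm : (Num.max a c < Num.min b d)%R.
  by rewrite gt_max !lt_min ab ad cb cd.
have [] := midf_lt lt_mm; rewrite gt_max lt_min.
move=> /andP[am cm] /andP[mb md].
by exists ((Num.max a c + Num.min b d) / 2)%R; rewrite /= !in_itv /= am cm mb md.
Qed.

(** * Upper bound: d-adic intervals *)

Section NatIntervals.
Variables (V : finType) (a b : V -> nat).

Definition nat_interval_adj : rel V :=
  fun x y => [&& x != y, a x < b y & a y < b x].

Lemma nat_interval_adj_sym : symmetric nat_interval_adj.
Proof.
by move=> x y; rewrite /nat_interval_adj eq_sym [(a x < _) && _]andbC.
Qed.

Lemma nat_interval_adj_irrefl : irreflexive nat_interval_adj.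
Proof. by move=> x; rewrite /nat_interval_adj eqxx. Qed.

Definition nat_interval_graph :=
  SGraph nat_interval_adj_sym nat_interval_adj_irrefl.

Lemma nat_interval_graphP (R : realType) : (forall x, a x < b x) ->
  interval_graph R nat_interval_graph.
Proof.
move=> ltab; exists (fun x => (a x)%:R%R), (fun x => (b x)%:R%R).
split=> [x|x y neq_xy]; first by rewrite ltr_nat.
apply: iff_sym; apply: iff_trans (open_itvs_meetE _ _ _ _ _ _ _) _.
- by rewrite ltr_nat.
- by rewrite ltr_nat.
- by rewrite /adj /= /nat_interval_adj neq_xy !ltr_nat.
Qed.

Variables (v k : nat).
Let d := v.+1.
Hypothesis v_gt0 : 0 < v.
Hypothesis ltab : forall x, a x < b x.
(** Further vertices are allowed, so that the graph can be padded to any larger size. *)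
Hypothesis d_adic : forall h i, h <= k -> i < d ^ (k - h) ->
  exists x, a x = i * d ^ h /\ b x = i.+1 * d ^ h.

Lemma d_adic_colours (c : V -> 'I_k) :
  (forall i, @claw_le nat_interval_graph v [set x | c x == i]) ->
  forall h i, h <= k -> i < d ^ (k - h) ->
  h < #|[set c x | x : V & (i * d ^ h <= a x) && (b x <= i.+1 * d ^ h)]|.
Proof.
move=> clawc; elim=> [|h IHh] i le_hk lt_i.
  have [x [ax bx]] := d_adic 0 i le_hk lt_i.
  by apply/card_gt0P; exists (c x); apply/imsetP; exists x; rewrite // inE ax bx !leqnn.
have [x [ax bx]] := d_adic h.+1 i le_hk lt_i.
have lt_child (j : 'I_d) : i * d + j < d ^ (k - h).
  rewrite -[k - h](@prednK) ?subn_gt0 // -subnS expnS.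
  have := leq_mul lt_i (leqnn d); have := ltn_ord j.
  by rewrite [d * _]mulnC mulSn; lia.
have nested (j : 'I_d) l r : (i * d + j) * d ^ h <= l -> r <= (i * d + j).+1 * d ^ h ->
    (i * d ^ h.+1 <= l) && (r <= i.+1 * d ^ h.+1).
  move=> le_l le_r; rewrite expnS !mulnA; apply/andP; split.
    by apply: leq_trans le_l; rewrite leq_mul2r leq_addr orbT.
  apply: leq_trans le_r _; rewrite leq_mul2r; apply/orP; right.
  by have := ltn_ord j; rewrite mulSn; lia.
pose used (j : 'I_d) := [set c y | y : V &
  ((i * d + j) * d ^ h <= a y) && (b y <= (i * d + j).+1 * d ^ h)].
have [/forallP all_used|] := boolP [forall j, c x \in used j]; last first.
  (* Child [j] lacks the colour of [x]: its h + 1 colours together with [c x] make h + 2. *)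
  rewrite negb_forall => /existsP[j cxj].
  have := IHh _ (ltnW le_hk) (lt_child j); rewrite -/(used j) => lt_h.
  apply: leq_ltn_trans lt_h _.
  rewrite -[X in X <= _](_ : #|c x |: used j| = _); last by rewrite cardsU1 cxj.
  apply: subset_leq_card; rewrite subUset sub1set; apply/andP; split.
    by apply/imsetP; exists x; rewrite // inE ax bx !leqnn.
  apply: imsetS; apply/subsetP => y; rewrite !inE => /andP[le_a le_b].
  exact: nested le_a le_b.
(* Otherwise each child contains an interval coloured like [x]; these are the d leaves of the
   forbidden claw. *)
have leafP (j : 'I_d) : exists y, [/\ c y = c x, (i * d + j) * d ^ h <= a y &
    b y <= (i * d + j).+1 * d ^ h].
  have /imsetP[y] := all_used j; rewrite inE => /andP[ya yb] ->.
  by exists y.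
have [leaf leafE] := fin_all_exists leafP.
have leaf_disjoint (j j' : 'I_d) : j < j' -> b (leaf j) <= a (leaf j').
  move=> lt_jj'; have [_ _ le_b] := leafE j; have [_ le_a _] := leafE j'.
  apply: leq_trans le_b (leq_trans _ le_a).
  by rewrite leq_mul2r -addnS leq_add2l lt_jj' orbT.
have injleaf : injective leaf.
  move=> j j' eq_leaf.
  by case: (ltngtP j j') => [/leaf_disjoint|/leaf_disjoint|/val_inj //];
    rewrite eq_leaf leqNgt ltab.
suff : #|leaf @: [set: 'I_d]| <= v.
  by rewrite (card_imset _ injleaf) cardsT card_ord ltnn.
apply: (clawc (c x) x).
- by rewrite inE.
- by apply/subsetP => _ /imsetP[j _ ->]; rewrite inE; have [-> _ _] := leafE j.
- move=> _ /imsetP[j _ ->]; have [_ le_a le_b] := leafE j.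
  have /andP[le_a' le_b'] := nested _ _ _ le_a le_b.
  have lt_leaf := ltab (leaf j).
  rewrite /adj /= /nat_interval_adj ax bx.
  rewrite (leq_ltn_trans le_a' lt_leaf) (leq_trans lt_leaf le_b') !andbT.
  (* A leaf equal to [x] would fit the parent into a single child, forcing d <= 1 against
     [v_gt0]. *)
  apply/negP => /eqP eq_x; move: le_a le_b; rewrite -eq_x ax bx expnS !mulnA.
  rewrite !leq_pmul2r ?expn_gt0 // -[X in _ <= X]addn0 leq_add2l leqn0.
  by move=> /eqP ->; rewrite addn0 mulSn -addn1 addnC leq_add2l /d ltnNge v_gt0.
- move=> _ _ /imsetP[j _ ->] /imsetP[j' _ ->]; rewrite /adj /= /nat_interval_adj.
  apply/negP => /and3P[neq lt1 lt2].
  case: (ltngtP j j') => [/leaf_disjoint|/leaf_disjoint|/val_inj eq_jj'].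
  + by rewrite leqNgt lt2.
  + by rewrite leqNgt lt1.
  + by rewrite eq_jj' eqxx in neq.
Qed.

Lemma d_adic_no_claw_partition : ~ claw_partition k v nat_interval_graph.
Proof.
case=> c /= clawc.
have := d_adic_colours c (fun i => (claw_number_inducedP _ _ _).1 (clawc i)) k 0 (leqnn k).
rewrite subnn => /(_ isT); rewrite ltnNge.
by rewrite (leq_trans (max_card _)) // card_ord.
Qed.

End NatIntervals.

(** * Counterexamples of every larger size, and the closed form *)

Lemma mu_valueE (v k : nat) : (mu_value v k).+1 = \sum_(l < k.+1) v.+1 ^ l.
Proof.
elim: k => [|k IHk]; first by rewrite big_ord1.
rewrite big_ord_recl /= IHk big_distrr /= add1n; congr _.+1.
by apply: eq_bigr => i _; rewrite expnS.
Qed.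

Lemma not_all_claw_partition (R : realType) (k v m : nat) : 0 < v ->
  mu_value v k < m -> ~ all_claw_partition R k v m.
Proof.
move=> v_gt0 lt_m allm.
(* The pair (l, i) encodes the d-adic interval number i, from 0, at depth l, of length d^(k-l). *)
pose nodes := [seq (l, i) | l <- iota 0 k.+1, i <- iota 0 (v.+1 ^ l)].
have size_nodes : size nodes <= m.
  rewrite size_allpairs_dep sumnE big_map -/(index_iota 0 k.+1) big_mkord.
  by under eq_bigr do rewrite size_iota; rewrite -mu_valueE.
(* Surplus vertices get the default node (0, 0), a duplicate of the root. *)
pose node (x : 'I_m) := nth (0, 0) nodes x.
pose a x := (node x).2 * v.+1 ^ (k - (node x).1).
pose b x := (node x).2.+1 * v.+1 ^ (k - (node x).1).
have ltab x : a x < b x by rewrite ltn_mul2r expn_gt0 /=.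
apply: (@d_adic_no_claw_partition _ a b v k v_gt0 ltab); last first.
  by apply: allm; [rewrite card_ord | exact: nat_interval_graphP].
move=> h i le_hk lt_i.
have node_in : (k - h, i) \in nodes.
  by apply/allpairsPdep; exists (k - h), i; rewrite !mem_iota !add0n ltnS leq_subr lt_i.
have lt_index : index (k - h, i) nodes < m.
  by apply: leq_trans size_nodes; rewrite index_mem.
exists (Ordinal lt_index); rewrite /a /b /node /= nth_index //=.
by rewrite subKn.
Qed.

Local Open Scope ring_scope.

Theorem theorem1 (R : realType) (k v : nat) (hk : (1 <= k)%N) (hv : (1 <= v)%N) :
  exists n : nat,
    is_mu R k v n /\
    n%:R = ((v%:R + 1) ^+ (k + 1) - (v%:R + 1)) / v%:R :> rat.
Proof.
exists (mu_value v k); split; last first.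
  have v_neq0 : v%:R != 0 :> rat by rewrite pnatr_eq0 -lt0n.
  apply: (canRL (mulfK v_neq0)).
  (* Cleared of the denominator, the identity follows the recursion from k = 0, where both sides
     vanish. *)
  elim: k {hk} => [|k IHk] /=; first by rewrite expr1 subrr mul0r.
  rewrite natrM !mulrSr mulrC mulrCA mulrDr mulr1 [v%:R * _]mulrC IHk.
  by rewrite addSn exprS; ring.
split=> [G cardG [a [b [ltab adjP]]]|m allm]; last first.
  by rewrite leqNgt; apply/negP => /(not_all_claw_partition R k v m hv).
apply: partitionableT => //; apply: (partitionable_card R G a b) => // [x y neq_xy|].
  apply/idP/idP.
    by move=> /(adjP _ _ neq_xy) /open_itvs_meetE; apply.
  by move=> meet; apply/(adjP _ _ neq_xy)/open_itvs_meetE.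
by rewrite cardsT cardG.
Qed.
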